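(* Let $T:X\to\mathcal{R}_\Omega(Y)$ be a linear random operator and let $\alpha_T$ be the probability of $T$ being continuous. Then $T$ is probably continuous with probability (equal to) $\alpha_T$ if and only if $T$ has a probably closed graph with probability (equal to) $\alpha_T$.
   Context: $(\Omega,\mathcal{A},\mathbb{P})$ is a fixed probability space, and $X$ and $Y$ are Banach spaces over the same scalar field ($\mathbb{R}$ or $\mathbb{C}$). A $Y$-valued random variable is a map $y:\Omega\to Y$ such that $y^{-1}(B)\in\mathcal{A}$ for every Borel set $B\subset Y$. $\mathcal{R}_\Omega(Y)$ denotes the linear space (taken as such throughout) of all $Y$-valued random variables on $\Omega$, with almost surely equal random variables identified. For $y\in\mathcal{R}_\Omega(Y)$ and $\tau\in\mathbb{R}$, $[\|y\|<\tau]=\{\omega\in\Omega:\|y(\omega)\|<\tau\}$, and similarly for $\le$, $\ge$, $=$, etc. A sequence $(y_n)$ in $\mathcal{R}_\Omega(Y)$ converges in probability to $y\in\mathcal{R}_\Omega(Y)$ if $\lim_{n\to\infty}\mathbb{P}[\|y_n-y\|\ge\tau]=0$ for all $\tau>0$. A linear random operator is a map $T:X\to\mathcal{R}_\Omega(Y)$ such that $\mathbb{P}[T(ax+by)=aT(x)+bT(y)]=1$ for all $x,y\in X$ and all scalars $a,b$. For $\alpha\in[0,1]$, $T$ is probably continuous with probability $\ge\alpha$ if for every $x_0\in X$, every $\tau>0$ and every $0<\varepsilon<\alpha$ there is $\delta>0$ such that $\mathbb{P}[\|T(x)-T(x_0)\|<\tau]>\varepsilon$ whenever $x\in X$ and $\|x-x_0\|<\delta$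 (a vacuous condition when $\alpha=0$). $T$ is probably continuous with probability (equal to) $\alpha$ if $\alpha$ is the largest number in $[0,1]$ such that $T$ is probably continuous with probability $\ge\alpha$. $T$ is called probably continuous if it is probably continuous with probability $\ge\alpha$ for some $\alpha\in(0,1]$. If $T$ is probably continuous, $\alpha_T$ is the supremum of the set of those $\alpha\in(0,1]$ such that for every $0<\varepsilon<\alpha$ there is $M_\varepsilon\ge 0$ with $\mathbb{P}[\|T(x)\|\le M_\varepsilon\|x\|]>\varepsilon$ for all $x\in X$; if $T$ is not probably continuous, $\alpha_T=0$. The number $\alpha_T$ is called the probability of $T$ being continuous. The separating subspace of $T$ is $S(T)=\{y\in\mathcal{R}_\Omega(Y):\text{there is a sequence }(x_n)\text{ in }X\text{ with }x_n\to 0\text{ and }T(x_n)\to y\text{ in probability}\}$. For $\alpha\in[0,1]$, $T$ has a probably closed graph with probability $\ge\alpha$ if $\mathbb{P}[y=0]\ge\alpha$ for all $y\in S(T)$; it has a probably closed graph with probability (equal to) $\alpha$ if $\alpha$ is the largest number in $[0,1]$ with this property. *)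

(* Defs.v *)
From HB Require Import structures.
From mathcomp Require Import all_boot all_order all_algebra.
From mathcomp Require Import complex.
From mathcomp Require Import all_classical all_reals all_analysis.

Set Implicit Arguments.
Unset Strict Implicit.
Unset Printing Implicit Defensive.

Import Order.TTheory GRing.Theory Num.Theory.
Import numFieldNormedType.Exports.

Local Open Scope classical_set_scope.
Local Open Scope ring_scope.

Variant scalar_kind := RealScalars | ComplexScalars.

Definition scalars (R : realType) (k : scalar_kind) : numFieldType :=
  match k with
  | RealScalars => R
  | ComplexScalars => R[i]
  end.

Definition scalar_re (R : realType) (k : scalar_kind) : scalars R k -> R :=
  match k return scalars R k -> R with
  | RealScalars => fun a => a
  | ComplexScalars => fun a => complex.Re a
  end.

(* In the library the norm of a normed module over K takes its values in K;
   for K = R[i] these values are nonnegative, hence real, and [rnorm] is the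
   same number seen in R. *)
Definition rnorm (R : realType) (k : scalar_kind)
  (V : normedModType (scalars R k)) (v : V) : R := scalar_re `|v|.

Section RandomOperators.
Context d (Omega : measurableType d) (R : realType) (P : probability Omega R).
Context (k : scalar_kind) (X Y : completeNormedModType (scalars R k)).

Definition borel : measurableType (@open Y).-sigma :=
  g_sigma_algebraType (@open Y).

(* The quotient, by almost sure equality, of the set of Borel maps. *)
Definition random_var : Type := {mfun_ P, Omega >-> borel}.

(* A representative; every event below is, up to a null set, independent of
   the choice. *)
Definition rv_val (y : random_var) : Omega -> Y :=
  (y : {mfun_ P, Omega >-> borel}).

(* If Y is not separable, the sum of two Borel maps need not be Borel. *)
Definition random_vars_linear_space :=
  forall (a b : scalars R k) (y z : {RV P >-> borel}),
    measurable_fun [set: Omega]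
      ((fun w => a *: (y w : Y) + b *: (z w : Y)) : Omega -> borel).

Definition cvg_in_probability (y_ : nat -> random_var) (y : random_var) :=
  forall tau : R, 0 < tau ->
    P [set w | tau <= rnorm (rv_val (y_ n) w - rv_val y w)] @[n --> \oo]
      --> 0%E.

Definition largest_in01 (Q : R -> Prop) (alpha : R) :=
  [/\ 0 <= alpha <= 1, Q alpha
    & forall beta, 0 <= beta <= 1 -> Q beta -> beta <= alpha].

Definition linear_random_operator (T : X -> random_var) :=
  forall (a b : scalars R k) (x z : X),
    P [set w | rv_val (T (a *: x + b *: z)) w
               = a *: rv_val (T x) w + b *: rv_val (T z) w] = 1%E.

Definition probably_continuous_ge (T : X -> random_var) (alpha : R) :=
  forall (x0 : X) (tau eps : R), 0 < tau -> 0 < eps < alpha ->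
    exists2 delta : R, 0 < delta &
      forall x : X, rnorm (x - x0) < delta ->
        (eps%:E < P [set w | (rnorm (rv_val (T x) w - rv_val (T x0) w) < tau)%R])%E.

Definition probably_continuous_eq (T : X -> random_var) (alpha : R) :=
  largest_in01 (probably_continuous_ge T) alpha.

Definition probably_continuous (T : X -> random_var) :=
  exists2 alpha : R, 0 < alpha <= 1 & probably_continuous_ge T alpha.

Definition probably_bounded_ge (T : X -> random_var) (alpha : R) :=
  forall eps : R, 0 < eps < alpha ->
    exists2 M : R, 0 <= M &
      forall x : X,
        (eps%:E < P [set w | (rnorm (rv_val (T x) w) <= M * rnorm x)%R])%E.

(* The set is bounded by 1, and for a probably continuous linear random
   operator it is nonempty, so the real-valued [sup] is the actual supremum. *)
Definition probability_of_continuity (T : X -> random_var) : R :=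
  if `[< probably_continuous T >]
  then sup [set alpha : R | 0 < alpha <= 1 /\ probably_bounded_ge T alpha]
  else 0.

Definition separating_subspace (T : X -> random_var) : set random_var :=
  [set y | exists2 x_ : nat -> X, x_ n @[n --> \oo] --> (0 : X)
           & cvg_in_probability (fun n => T (x_ n)) y].

Definition probably_closed_graph_ge (T : X -> random_var) (alpha : R) :=
  forall y, separating_subspace T y ->
    (alpha%:E <= P [set w | rv_val y w = 0%R])%E.

Definition probably_closed_graph_eq (T : X -> random_var) (alpha : R) :=
  largest_in01 (probably_closed_graph_ge T) alpha.

End RandomOperators.

(* Main.v *)
(* Both properties amount to [alpha_T] being the largest number satisfying a
   condition, so it is enough that the two conditions agree for every [alpha] in
   [0, 1].

   Continuity with probability [alpha] gives the closed graph by splitting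
   [y = (y - T x_n) + T x_n].  Conversely, Baire's theorem makes [T] nearly
   continuous: [x] is approximated by points where [T] is close in probability
   to [T x0].  Iterating with geometrically decreasing errors yields [s_n --> x]
   such that [T s_n] converges in probability to some [f] close to [T x0].  Then
   [T x - f] lies in the separating subspace, so [T x = f] with probability at
   least [alpha]. *)
Require Import Defs.
From HB Require Import structures.
From mathcomp Require Import all_boot all_order all_algebra.
From mathcomp Require Import complex.
From mathcomp Require Import all_classical all_reals all_analysis.
From mathcomp Require Import ring lra.

Set Implicit Arguments.
Unset Strict Implicit.
Unset Printing Implicit Defensive.

Import Order.TTheory GRing.Theory Num.Theory.
Import numFieldNormedType.Exports.

Local Open Scope classical_set_scope.
Local Open Scope ring_scope.

(** * Real scalars inside the scalar field, and the real-valued norm *)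

Definition scalar_of_real (R : realType) (k : scalar_kind) : R -> scalars R k :=
  match k return R -> scalars R k with
  | RealScalars => id
  | ComplexScalars => fun a => a%:C%C
  end.

Section RealNorm.
Context (R : realType) (k : scalar_kind).
Local Notation K := (scalars R k).
Local Notation inK := (@scalar_of_real R k).

Lemma scalar_of_realD a b : inK (a + b) = inK a + inK b.
Proof. by case: k => //=; rewrite rmorphD. Qed.

Lemma scalar_of_realM a b : inK (a * b) = inK a * inK b.
Proof. by case: k => //=; rewrite rmorphM. Qed.

Lemma scalar_of_real0 : inK 0 = 0.
Proof. by case: k. Qed.

Lemma scalar_of_real1 : inK 1 = 1.
Proof. by case: k. Qed.

Lemma scalar_of_real_lt a b : (inK a < inK b) = (a < b).
Proof. by case: k => //=; rewrite ltcR. Qed.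

Lemma scalar_of_real_le a b : (inK a <= inK b) = (a <= b).
Proof. by case: k => //=; rewrite lecR. Qed.

Lemma scalar_of_real_norm a : `|inK a| = inK `|a|.
Proof.
by case: k => //=; rewrite normc_def /= expr0n addr0 sqrtr_sqr.
Qed.

(** An element of [K] comparable with 0 is real, so norms and radii pass to [R] without loss. *)
Lemma scalar_re_ge0 (e : K) : 0 <= e -> inK (scalar_re e) = e.
Proof.
case: k e => //= e e0; apply: RRe_real; exact: ger0_real.
Qed.

Section Norm.
Context (V : normedModType K).
Implicit Types u v w : V.

Lemma normE v : `|v| = inK (rnorm v).
Proof. by rewrite scalar_re_ge0. Qed.

Lemma rnorm_ge0 v : 0 <= rnorm v.
Proof. by rewrite -scalar_of_real_le -normE scalar_of_real0. Qed.

Lemma rnormD u v : rnorm (u + v) <= rnorm u + rnorm v.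
Proof. by rewrite -scalar_of_real_le scalar_of_realD -!normE ler_normD. Qed.

Lemma rnormB u v : rnorm (u - v) = rnorm (v - u).
Proof. by rewrite /rnorm distrC. Qed.

Lemma rnormZ a v : rnorm (inK a *: v) = `|a| * rnorm v.
Proof.
apply/eqP; rewrite eq_le -!scalar_of_real_le -eq_le scalar_of_realM.
by rewrite -!normE -scalar_of_real_norm normrZ.
Qed.

Lemma rnorm0 : rnorm (0 : V) = 0.
Proof. by rewrite /rnorm normr0; case: (k). Qed.

Lemma rnorm0_eq0 v : rnorm v = 0 -> v = 0.
Proof. by move=> v0; apply/normr0_eq0; rewrite normE v0 scalar_of_real0. Qed.

Lemma rdist_triangle v u w : rnorm (u - w) <= rnorm (u - v) + rnorm (v - w).
Proof. by apply: le_trans (rnormD _ _); rewrite addrA subrK. Qed.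

Lemma nbhs_rnormP v (A : set V) :
  nbhs v A <-> exists2 r, 0 < r & forall u, rnorm (v - u) < r -> A u.
Proof.
split=> [/nbhs_ballP[e /= e0 eA]|[r r0 rA]].
  exists (scalar_re e) => [|u vu].
    by rewrite -scalar_of_real_lt scalar_re_ge0 ?ltW// scalar_of_real0.
  apply: eA; rewrite -ball_normE /ball_ /= normE.
  by rewrite -(scalar_re_ge0 (ltW e0)) scalar_of_real_lt.
apply/nbhs_ballP; exists (inK r) => /=.
  by rewrite -scalar_of_real0 scalar_of_real_lt.
move=> u; rewrite -ball_normE /ball_ /= normE scalar_of_real_lt; exact: rA.
Qed.

Lemma cvg_rnormP (u : nat -> V) v :
  u n @[n --> \oo] --> v <->
  forall e, 0 < e -> \forall n \near \oo, rnorm (v - u n) < e.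
Proof.
split=> [uv e e0|uv A /nbhs_rnormP[r r0 rA]].
  have /uv : nbhs v [set w | rnorm (v - w) < e] by apply/nbhs_rnormP; exists e.
  exact.
by apply: filterS (uv _ r0) => n; exact: rA.
Qed.

Lemma open_rnorm_lt v r : open [set u | rnorm (v - u) < r].
Proof.
rewrite openE => u /= vu; apply/nbhs_rnormP.
exists (r - rnorm (v - u)); first by rewrite subr_gt0.
by move=> w uw /=; have := rdist_triangle u v w; lra.
Qed.

Lemma closed_rnorm_le v r : closed [set u | rnorm (v - u) <= r].
Proof.
rewrite -openC openE => u /= /negP; rewrite -ltNge => vu; apply/nbhs_rnormP.
exists (rnorm (v - u) - r); first by rewrite subr_gt0.
move=> w uw /=; apply/negP; rewrite -ltNge.
by have := rdist_triangle w v u; rewrite (rnormB w u); lra.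
Qed.

Lemma closed_rnorm0 : closed [set (0 : V)].
Proof.
rewrite (_ : [set 0] = [set u : V | rnorm (0 - u) <= 0]).
  exact: closed_rnorm_le.
apply/seteqP; split=> [u ->|u] /=; first by rewrite subr0 rnorm0.
rewrite rnormB subr0 => u0; apply: rnorm0_eq0.
by apply/eqP; rewrite eq_le u0 rnorm_ge0.
Qed.

(** * Geometrically convergent sequences and Baire's theorem *)

Lemma geometric_dist (u : nat -> V) c m n : (m <= n)%N ->
  (forall i, (m <= i)%N -> rnorm (u i.+1 - u i) <= c * 2^-1 ^+ i) ->
  rnorm (u n - u m) <= 2 * c * (2^-1 ^+ m - 2^-1 ^+ n).
Proof.
(* The difference of powers closes the induction: passing from [n] to [n.+1] adds exactly
   [c * 2^-1 ^+ n] to the bound. *)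
move=> + uc; elim: n => [|n IH].
  by rewrite leqn0 => /eqP ->; rewrite !subrr rnorm0 mulr0.
rewrite leq_eqVlt => /orP[/eqP ->|]; first by rewrite !subrr rnorm0 mulr0.
rewrite ltnS => mn; have := uc _ mn; have := IH mn.
by have := rdist_triangle (u n) (u n.+1) (u m); rewrite exprS; lra.
Qed.

Lemma geometric_lim_dist (u : nat -> V) c m l : 0 <= c ->
  (forall i, (m <= i)%N -> rnorm (u i.+1 - u i) <= c * 2^-1 ^+ i) ->
  u n @[n --> \oo] --> l -> rnorm (l - u m) <= 2 * c * 2^-1 ^+ m.
Proof.
move=> c0 uc /cvg_rnormP ul; apply/ler_addgt0Pr => e /ul[N _ Ne].
have := Ne (maxn m N) (leq_maxr _ _).
have := geometric_dist (leq_maxl m N) uc.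
have := rdist_triangle (u (maxn m N)) l (u m).
have : 0 <= c * 2^-1 ^+ (maxn m N) by rewrite mulr_ge0// exprn_ge0.
lra.
Qed.

End Norm.

Lemma half_exp_small (c e : R) : 0 < e ->
  exists N, forall n, (N <= n)%N -> c * 2^-1 ^+ n < e.
Proof.
move=> e0.
have /cvgrPdist_lt/(_ e e0)[N _ Ne] :
  (geometric c (2^-1 : R)) n @[n --> \oo] --> (0 : R).
  by apply: cvg_geometric; rewrite gtr0_norm ?invr_gt0//; lra.
exists N => n /Ne /=; rewrite sub0r normrN; exact/le_lt_trans/ler_norm.
Qed.

Context (V : completeNormedModType K).

Lemma geometric_cvg (u : nat -> V) c m :
  (forall i, (m <= i)%N -> rnorm (u i.+1 - u i) <= c * 2^-1 ^+ i) ->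
  exists l : V, u n @[n --> \oo] --> l.
Proof.
move=> uc; suff /cvg_ex : cvg (u @ \oo) by [].
apply: cauchy_cvg; apply: cauchy_exP => e e0.
have re0 : 0 < scalar_re e.
  by rewrite -scalar_of_real_lt scalar_re_ge0 ?ltW// scalar_of_real0.
have [N Ne] := half_exp_small (2 * `|c|) re0.
exists (u (maxn m N)), (maxn m N) => // n /= mNn.
rewrite -ball_normE /ball_ /= normE -(scalar_re_ge0 (ltW e0)) scalar_of_real_lt.
rewrite rnormB; apply: le_lt_trans (Ne _ (leq_maxr m N)).
apply: le_trans (geometric_dist (c := `|c|) mNn _) _ => [i mi|].
  apply: le_trans (uc i (leq_trans (leq_maxl _ _) mi)) _.
  by rewrite ler_wpM2r ?exprn_ge0// ler_norm.
by rewrite ler_wpM2l ?mulr_ge0// lerBlDr lerDl exprn_ge0.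
Qed.

(* Restated for the real-valued norm because the library's [Baire] only covers
   real scalars. *)
Lemma baire_rnorm (A : nat -> set V) : (forall x, exists n, A n x) ->
  exists n x, exists2 r, 0 < r & forall u, rnorm (u - x) < r ->
    forall rho, 0 < rho -> exists2 v, A n v & rnorm (u - v) < rho.
Proof.
move=> Acover; apply: contrapT => nA.
(* A pair is a ball, centre and radius. As [A n] is dense in no ball, each closed ball contains one
   of at most half the radius that misses [A n]. *)
have step n (xr : V * R) : exists yr : V * R, 0 < xr.2 ->
    [/\ rnorm (yr.1 - xr.1) <= xr.2 / 2, 0 < yr.2, yr.2 <= xr.2 / 2
      & forall v, A n v -> yr.2 < rnorm (yr.1 - v)].
  have [r0|?] := pselect (0 < xr.2); last by exists xr.
  apply: contrapT => nex; apply: nA; exists n, xr.1, (xr.2 / 2); first lra.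
  move=> u ux rho rho0; apply: contrapT => nv; apply: nex.
  (* Points of [A n] are at distance at least [rho] from [u]; halving [rho] makes the separation
     strict. *)
  exists (u, Num.min (rho / 2) (xr.2 / 2)) => _; split => /=.
  - exact: ltW.
  - by rewrite lt_min; apply/andP; split; lra.
  - by rewrite ge_min lexx orbT.
  - move=> v Av; rewrite gt_min; apply/orP; left.
    by rewrite ltNge; apply/negP => uv; apply: nv; exists v => //; lra.
have [f fP] := choice (fun nxr : nat * (V * R) => step nxr.1 nxr.2).
pose fix s n := if n is m.+1 then f (m, s m) else (0 : V, 1 : R).
have s0 n : 0 < (s n).2.
  by elim: n => [|n IH] /=; [exact: ltr01|have [] := fP (n, s n) IH].
have sP n : _ := fP (n, s n) (s0 n).
(* Halving of the radii, in the form [c * 2^-1 ^+ n] that the geometric estimates take. *)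
have sr m n : (m <= n)%N -> (s n).2 <= (s m).2 * 2 ^+ m * 2^-1 ^+ n.
  elim: n => [|n IH].
    by rewrite leqn0 => /eqP ->; rewrite !expr0 !mulr1.
  rewrite leq_eqVlt => /orP[/eqP ->|/IH].
    by rewrite -mulrA -exprMn divff// expr1n mulr1.
  by have [_ _ /=] := sP n; rewrite exprS; lra.
have scauchy m i : (m <= i)%N ->
    rnorm ((s i.+1).1 - (s i).1) <= (s m).2 * 2 ^+ m / 2 * 2^-1 ^+ i.
  by move=> /sr; have [/= ] := sP i; lra.
have [l sl] := geometric_cvg (scauchy 0%N).
(* The geometric bound is exactly the radius, so the limit lies in every closed ball and hence in no
   [A n]. *)
have sl_dist m : rnorm (l - (s m).1) <= (s m).2.
  have c0 : 0 <= (s m).2 * 2 ^+ m / 2.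
    by rewrite !mulr_ge0 ?exprn_ge0 ?invr_ge0// ltW.
  apply: le_trans (geometric_lim_dist c0 (scauchy m) sl) _.
  have : 2 ^+ m * 2^-1 ^+ m = 1 :> R by rewrite -exprMn divff// expr1n.
  move: (2 ^+ m) (2^-1 ^+ m) => a b ab.
  have -> : 2 * ((s m).2 * a / 2) * b = (s m).2 * (a * b) by field.
  by rewrite ab mulr1.
have [n Anl] := Acover l.
have [_ _ _ /(_ _ Anl)/=] := sP n.
by have := sl_dist n.+1; rewrite rnormB /=; lra.
Qed.

End RealNorm.

(** * Borel maps into a Banach space *)

Section BorelMaps.
Context d (Omega : measurableType d) (R : realType) (k : scalar_kind).
Context (Y : completeNormedModType (scalars R k)).
Implicit Types f g : Omega -> Y.

Definition borel_map f := measurable_fun [set: Omega] (f : Omega -> borel Y).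

Lemma borel_mapP f :
  borel_map f <-> forall U, open U -> measurable (f @^-1` U).
Proof.
split=> [mf U oU|mf].
  rewrite -[X in measurable X]setTI; apply: mf => //.
  exact: sub_sigma_algebra.
apply: (@measurability _ _ Omega (borel Y) setT f (@open Y)) => // _ [U oU <-].
by rewrite setTI; exact: mf.
Qed.

Lemma borel_map_closed f (C : set Y) :
  borel_map f -> closed C -> measurable (f @^-1` C).
Proof.
move=> /borel_mapP mf cC; rewrite -[C]setCK preimage_setC.
have oC : open (~` C) by rewrite openC.
by apply: measurableC; exact: mf oC.
Qed.

Lemma borel_map_if f g (A : set Omega) : measurable A ->
  borel_map f -> borel_map g ->
  borel_map (fun w => if `[< A w >] then f w else g w).
Proof.
move=> mA /borel_mapP mf /borel_mapP mg; apply/borel_mapP => U oU.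
rewrite (_ : _ @^-1` U = (A `&` f @^-1` U) `|` (~` A `&` g @^-1` U)).
  apply: measurableU; apply: measurableI;
    [by []|exact: mf|exact: measurableC|exact: mg].
apply/seteqP; split=> w /=.
  by case: asboolP => Aw Uw; [left|right].
by case: asboolP => Aw -[] [].
Qed.

(* A point lies in the open set [U] iff some ball around it does, and the set of
   centres of balls of a fixed radius contained in [U] is closed. *)
Lemma borel_map_lim (f_ : nat -> Omega -> Y) f :
  (forall n, borel_map (f_ n)) ->
  (forall w, f_ n w @[n --> \oo] --> f w) -> borel_map f.
Proof.
move=> mf_ f_f; apply/borel_mapP => U oU.
pose C m := [set y : Y | forall z, rnorm (y - z) < 2^-1 ^+ m -> U z].
have closedC m : closed (C m).
  rewrite (_ : C m =
      \bigcap_(z in ~` U) ~` [set y | rnorm (z - y) < 2^-1 ^+ m]).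
    apply: closed_bigI => z _; rewrite closedC; exact: open_rnorm_lt.
  apply/seteqP; split=> y /= Cy z.
    by move=> nUz /=; rewrite rnormB => /Cy.
  by move=> yz; apply: contrapT => /Cy; apply; rewrite /= rnormB.
(* [f w] is in [U] iff, for some [m], [f_ n w] is in [C m] for all large [n]. Conversely, closedness
   puts [f w] in [C m], and a centre belongs to its own ball. *)
rewrite (_ : f @^-1` U = \bigcup_m \bigcup_N \bigcap_(n in [set n | (N <= n)%N])
    (f_ n @^-1` C m)).
  apply: bigcup_measurable => m _; apply: bigcup_measurable => N _.
  apply: bigcap_measurable => [|n _]; first by exists N => /=.
  exact: borel_map_closed.
apply/seteqP; split=> w /=.
  move=> Ufw.
  have /nbhs_rnormP[r r0 rU] : nbhs (f w) U by exact: open_nbhs_nbhs.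
  (* One [2^-1 ^+ m] for the distance from [f w] to [f_ n w], another for the ball around
     [f_ n w]. *)
  have [m /(_ m (leqnn _)) mr] := half_exp_small 2 r0.
  have e0 : 0 < 2^-1 ^+ m :> R by rewrite exprn_gt0.
  have /cvg_rnormP/(_ _ e0)[N _ Nf] := f_f w.
  exists m => //; exists N => // n /= /Nf /= fn z fz; apply: rU.
  by have := rdist_triangle (f_ n w) (f w) z; lra.
move=> [m _ [N _ fC]].
have : C m (f w).
  apply: (closed_cvg _ (closedC m)) (f_f w).
  by exists N => // n /= Nn; exact: fC.
by apply; rewrite subrr rnorm0 exprn_gt0.
Qed.

Context (P : probability Omega R).

Lemma borel_map_rv (y : random_var P Y) : borel_map (rv_val y).
Proof. exact: measurable_funPT. Qed.

(** Equality is only almost sure because [rv_val] picks some representative of the class of [f]. *)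
Lemma random_var_of f : borel_map f ->
  exists y : random_var P Y, \forall w \ae P, rv_val y w = f w.
Proof.
move=> mf; have fmem : (f : Omega -> borel Y) \in mfun by rewrite inE.
pose F : {mfun Omega >-> borel Y} := mfun_Sub fmem.
exists (\pi_(random_var P Y)%qT F).
have /eqmodP/asboolP : repr (\pi_(random_var P Y)%qT F) = F
  %[mod random_var P Y]%qT by rewrite reprK.
by apply: filterS => w; exact.
Qed.

Hypothesis RY : random_vars_linear_space P Y.

(** Any Borel map can be bundled, so [RY] applies to it; this makes all the events on distances
    below measurable. *)
Lemma borel_map_lin a b f g : borel_map f -> borel_map g ->
  borel_map (fun w => a *: f w + b *: g w).
Proof.
move=> mf mg.
have fmem : (f : Omega -> borel Y) \in mfun by rewrite inE.
have gmem : (g : Omega -> borel Y) \in mfun by rewrite inE.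
exact: (RY a b (mfun_Sub fmem) (mfun_Sub gmem)).
Qed.

Lemma borel_mapB f g : borel_map f -> borel_map g ->
  borel_map (fun w => f w - g w).
Proof.
move=> mf mg; have := borel_map_lin 1 (-1) mf mg.
by under [X in borel_map X -> _]eq_fun do rewrite scale1r scaleN1r.
Qed.

Lemma measurable_dist_lt f g r : borel_map f -> borel_map g ->
  measurable [set w | rnorm (f w - g w) < r].
Proof.
move=> mf mg; have /borel_mapP/(_ _ (open_rnorm_lt 0 r)) := borel_mapB mg mf.
by congr measurable; apply/seteqP; split=> w /=; rewrite sub0r opprB.
Qed.

Lemma measurable_dist_le f g r : borel_map f -> borel_map g ->
  measurable [set w | rnorm (f w - g w) <= r].
Proof.
move=> mf mg.
have := borel_map_closed (borel_mapB mg mf) (@closed_rnorm_le _ _ _ (0 : Y) r).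
by congr measurable; apply/seteqP; split=> w /=; rewrite sub0r opprB.
Qed.

Lemma measurable_dist_gt f g r : borel_map f -> borel_map g ->
  measurable [set w | r < rnorm (f w - g w)].
Proof.
move=> mf mg; have := measurableC (measurable_dist_le r mf mg).
by congr measurable; apply/seteqP; split=> w /=; rewrite ltNge => /negP.
Qed.

Lemma measurable_dist_ge f g r : borel_map f -> borel_map g ->
  measurable [set w | r <= rnorm (f w - g w)].
Proof.
move=> mf mg; have := measurableC (measurable_dist_lt r mf mg).
by congr measurable; apply/seteqP; split=> w /=; rewrite leNgt => /negP.
Qed.

Lemma measurable_eq f g : borel_map f -> borel_map g ->
  measurable [set w | f w = g w].
Proof.
move=> mf mg.
have := borel_map_closed (borel_mapB mf mg) (@closed_rnorm0 _ _ Y).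
congr measurable; apply/seteqP; split=> w /=; first exact: subr0_eq.
by move=> ->; exact: subrr.
Qed.

End BorelMaps.

(** * Estimates of probabilities up to null sets *)

Section Probability.
Context d (Omega : measurableType d) (R : realType) (P : probability Omega R).
Implicit Types A B C : set Omega.

(** [A] is covered by [B], [C] and a null set. This turns triangle inequalities that hold almost
    surely into inequalities between probabilities. *)
Lemma ae_measure_leU A B C : measurable A -> measurable B -> measurable C ->
  (\forall w \ae P, A w -> B w \/ C w) -> (P A <= P B + P C)%E.
Proof.
move=> mA mB mC [N [mN N0 ABCN]].
have mBC : measurable (B `|` C) by exact: measurableU.
apply: (@le_trans _ _ (P ((B `|` C) `|` N))).
  apply: le_measure; rewrite ?inE//; first exact: measurableU.
  move=> w Aw; have [BCw|BCw] := pselect ((B `|` C) w); first by left.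
  by right; apply: ABCN => /(_ Aw).
apply: (@le_trans _ _ (P (B `|` C) + P N)%E); first exact: measureU2.
by rewrite [P N]N0 adde0; exact: measureU2.
Qed.

Lemma measure_small (A_ : nat -> set Omega) (e : R) :
  (forall n, measurable (A_ n)) ->
  (forall m n, (m <= n)%N -> A_ n `<=` A_ m) -> \bigcap_n A_ n = set0 ->
  0 < e -> exists n, (P (A_ n) <= e%:E)%E.
Proof.
move=> mA dA A0 e0.
have PA : (P \o A_) n @[n --> \oo] --> P (\bigcap_n A_ n).
  apply: nonincreasing_cvg_mu => //.
  - by apply: (le_lt_trans (probability_le1 P (mA 0%N))); rewrite ltry.
  - exact: bigcap_measurableType.
  - by move=> m n /dA; rewrite subsetEset.
move: PA; rewrite A0 measure0 => /fine_cvgP[_ /cvgrPdist_le/(_ e e0)[n _ An]].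
exists n; have := An n (leqnn n); rewrite /= sub0r normrN => nle.
rewrite -(fineK (fin_num_measure P _ (mA n))) lee_fin.
exact: le_trans (ler_norm _) nle.
Qed.

Lemma measure_cvg0P (A_ : nat -> set Omega) :
  P (A_ n) @[n --> \oo] --> 0%E <->
  forall e : R, 0 < e -> \forall n \near \oo, (P (A_ n) <= e%:E)%E.
Proof.
split=> [PA e e0|PA].
  have : nbhs (0%E : \bar R) [set x | (x <= e%:E)%E].
    apply: (filterS (P := [set x | (x < e%:E)%E])) => [x|]; first exact: ltW.
    apply: open_nbhs_nbhs; split; first exact: open_ereal_lt_ereal.
    by rewrite /= lte_fin.
  exact: PA.
apply/fine_cvgP; split.
  apply: filterS (PA 1 ltr01) => n PA1; rewrite ge0_fin_numE ?measure_ge0//.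
  exact: le_lt_trans PA1 (ltry _).
apply/cvgrPdist_le => e e0; apply: filterS (PA e e0) => n PAe /=.
rewrite sub0r normrN ger0_norm ?fine_ge0 ?measure_ge0//.
rewrite -lee_fin fineK// ge0_fin_numE ?measure_ge0//.
exact: le_lt_trans PAe (ltry _).
Qed.

(** Countable subadditivity; the partial sums are bounded by a telescoping expression. *)
Lemma measure_tail_geometric (D : nat -> set Omega) (eta : R) m :
  0 <= eta -> (forall n, measurable (D n)) ->
  (forall n, (P (D n) <= (eta * 2^-1 ^+ n)%:E)%E) ->
  (P (\bigcup_(n in ~` `I_m) D n) <= (2 * eta * 2^-1 ^+ m)%:E)%E.
Proof.
move=> eta0 mD PD.
have mU : measurable (\bigcup_(n in ~` `I_m) D n) by exact: bigcup_measurable.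
apply: le_trans (measure_sigma_subadditive_tail P mD mU (@subset_refl _ _)) _.
have partial n : (m <= n)%N ->
    (\sum_(m <= i < n) P (D i) <= (2 * eta * (2^-1 ^+ m - 2^-1 ^+ n))%:E)%E.
  elim: n => [|n IH].
    by rewrite leqn0 => /eqP ->; rewrite big_geq// subrr mulr0.
  rewrite leq_eqVlt => /orP[/eqP ->|]; first by rewrite big_geq// subrr mulr0.
  rewrite ltnS => mn; rewrite big_nat_recr//=.
  apply: le_trans (leeD (IH mn) (PD n)) _.
  by rewrite -EFinD lee_fin exprS; lra.
apply: lime_le; first by apply: is_cvg_nneseries => n _ _; exact: measure_ge0.
exists m => // n /= /partial /le_trans; apply.
by rewrite lee_fin ler_wpM2l ?mulr_ge0// lerBlDr lerDl exprn_ge0.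
Qed.

End Probability.

(** * Completeness with respect to fast convergence in probability *)

Section FastConvergence.
Context d (Omega : measurableType d) (R : realType) (P : probability Omega R).
Context (k : scalar_kind) (Y : completeNormedModType (scalars R k)).
Hypothesis RY : random_vars_linear_space P Y.

(** Borel-Cantelli argument: outside the union [E m] of the bad events from [m] on, all later steps
    are geometric, so the sequence converges pointwise with a rate; [E m] has small probability. *)
Lemma fast_cauchy_in_probability (f_ : nat -> Omega -> Y) (tau eta : R) :
  0 <= tau -> 0 <= eta -> (forall n, borel_map (f_ n)) ->
  (forall n, (P [set w | (tau * 2^-1 ^+ n < rnorm (f_ n.+1 w - f_ n w))%R]
              <= (eta * 2^-1 ^+ n)%:E)%E) ->
  exists2 f, borel_map f & forall m,
    (P [set w | (2 * tau * 2^-1 ^+ m < rnorm (f w - f_ m w))%R]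
     <= (2 * eta * 2^-1 ^+ m)%:E)%E.
Proof.
move=> tau0 eta0 mf_ Pf_.
set D := fun n => [set w | tau * 2^-1 ^+ n < rnorm (f_ n.+1 w - f_ n w)].
have mD n : measurable (D n) by exact: (measurable_dist_gt RY).
pose E m := \bigcup_(n in ~` `I_m) D n.
have mE m : measurable (E m) by apply: bigcup_measurable => n _; exact: mD.
have dE m n : (m <= n)%N -> E n `<=` E m.
  move=> mn w [i /= ni Di]; exists i => //=.
  by apply/negP; rewrite -leqNgt (leq_trans mn)// leqNgt; exact/negP.
(* Setting the maps to 0 on [E n] gives convergence everywhere, as [borel_map_lim] requires: a point
   is either in every [E n], or outside some [E m] and then [g_] agrees with [f_] from [m] on. *)
pose g_ n w := if `[< E n w >] then 0 else f_ n w.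
have mg_ n : borel_map (g_ n).
  by apply: borel_map_if => //; exact: measurable_cst.
have gE m w : ~ E m w -> forall n, (m <= n)%N -> g_ n w = f_ n w.
  by move=> nE n mn; rewrite /g_; case: asboolP => // /(dE _ _ mn).
have g_step m w : ~ E m w -> forall n, (m <= n)%N ->
    rnorm (g_ n.+1 w - g_ n w) <= tau * 2^-1 ^+ n.
  move=> nE n mn; rewrite !(gE m)//; last exact: leq_trans mn _.
  rewrite leNgt; apply/negP => Dn; apply: nE; exists n => //=.
  by apply/negP; rewrite -leqNgt.
have /choice[f g_f] : forall w, exists l : Y, g_ n w @[n --> \oo] --> l.
  move=> w; have [[m nE]|nE] := pselect (exists m, ~ E m w).
    exact: geometric_cvg (g_step _ _ nE).
  exists 0; rewrite (_ : (fun n => g_ n w) = fun=> 0); first exact: cvg_cst.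
  apply/funext => n; rewrite /g_; case: asboolP => // nEn.
  by exfalso; apply: nE; exists n.
have mf : borel_map f by exact: borel_map_lim mg_ g_f.
exists f => // m; apply: le_trans (measure_tail_geometric m eta0 mD Pf_).
apply: le_measure; rewrite ?inE; [exact: (measurable_dist_gt RY)|exact: mE|].
move=> w /= fw; apply: contrapT => nE.
have := geometric_lim_dist tau0 (g_step _ _ nE) (g_f w).
by rewrite (gE m)// leNgt fw.
Qed.

End FastConvergence.

(** * Near continuity and successive approximation for a linear random operator *)

Section ClosedGraph.
Context d (Omega : measurableType d) (R : realType) (P : probability Omega R).
Context (k : scalar_kind) (X Y : completeNormedModType (scalars R k)).
Hypothesis RY : random_vars_linear_space P Y.
Context (T : X -> random_var P Y) (T_linear : linear_random_operator T).
Local Notation inK := (@scalar_of_real R k).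
Local Notation Tv x := (rv_val (T x)).

Let mT x : borel_map (Tv x) := @borel_map_rv _ _ _ _ _ _ _.

Lemma ae_linear a b x z :
  \forall w \ae P, Tv (a *: x + b *: z) w = a *: Tv x w + b *: Tv z w.
Proof.
have mE := measurable_eq RY (mT (a *: x + b *: z))
  (borel_map_lin RY a b (mT x) (mT z)).
have := probability_setC P mE; rewrite T_linear subee// => PE0.
exists (~` [set w | Tv (a *: x + b *: z) w = a *: Tv x w + b *: Tv z w]).
by split=> //; exact: measurableC.
Qed.

Lemma ae_linearB x z : \forall w \ae P, Tv (x - z) w = Tv x w - Tv z w.
Proof.
have := ae_linear 1 (-1) x z; rewrite scale1r scaleN1r.
by apply: filterS => w ->; rewrite scale1r scaleN1r.
Qed.

Lemma ae_linear0 : \forall w \ae P, Tv 0 w = 0.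
Proof.
have := ae_linearB 0 0; rewrite subr0.
by apply: filterS => w ->; rewrite subrr.
Qed.

Lemma ae_linear_shift s t u v :
  \forall w \ae P, Tv (s + t *: (u - v)) w - Tv s w = t *: (Tv u w - Tv v w).
Proof.
have := ae_linear 1 t s (u - v); rewrite scale1r.
apply: filterS2 (ae_linearB u v) => w -> ->.
by rewrite scale1r addrC addKr.
Qed.

(* By Baire, some set [P [n < |T x - T 0|] <= eta / 2] is dense in a ball; its
   differences, rescaled, give the approximants [s']. *)
Lemma nearly_continuous tau eta : 0 < tau -> 0 < eta ->
  exists2 r, 0 < r & forall s x, rnorm (x - s) < r -> forall rho, 0 < rho ->
    exists2 s', rnorm (x - s') < rho &
      (P [set w | (tau < rnorm (Tv s' w - Tv s w))%R] <= eta%:E)%E.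
Proof.
move=> tau0 eta0.
pose A n := [set x | (P [set w | (n%:R < rnorm (Tv x w - Tv 0 w))%R]
                      <= (eta / 2)%:E)%E].
(* The sets [A n] cover [X]: for fixed [x] the events decrease to the empty set, the norm being
   finite at every point. *)
have [x|n [c [q q0 Adense]]] := @baire_rnorm _ _ X A.
  apply: measure_small; last by rewrite divr_gt0.
  - by move=> n; exact: (measurable_dist_gt RY).
  - by move=> m n mn w /=; apply: le_lt_trans; rewrite ler_nat.
  - apply/seteqP; split=> // w /= Hw.
    have := Hw (Num.truncn (rnorm (Tv x w - Tv 0 w))).+1 I.
    by rewrite /= ltNge ltW// truncnS_gt.
have n0 : 0 < 2 * n.+1%:R :> R by rewrite mulr_gt0.
(* With this scale, [tau < t * rnorm (Tv u w - Tv v w)] forces the norm beyond [2 * n.+1], hence [u]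
   or [v] beyond [n]; [n.+1] keeps the denominator positive. *)
pose t := tau / (2 * n.+1%:R).
have t0 : 0 < t by rewrite divr_gt0.
have tV0 : 0 < t^-1 by rewrite invr_gt0.
exists (t * q); first by rewrite mulr_gt0.
move=> s x xs rho rho0.
have rho0' : 0 < t^-1 * rho / 2 by rewrite !mulr_gt0// invr_gt0.
(* The radius [t * q] keeps this point in the ball where [A n] is dense; [u] approximates it and [v]
   approximates [c]. *)
have uc : rnorm (c + inK t^-1 *: (x - s) - c) < q.
  by rewrite addrAC subrr add0r rnormZ gtr0_norm// ltr_pdivrMl.
have [u Au cu] := Adense _ uc _ rho0'.
have cc : rnorm (c - c) < q by rewrite subrr rnorm0.
have [v Av cv] := Adense _ cc _ rho0'.
(* [x - s'] is [t] times the difference of two errors below [t^-1 * rho / 2], and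
   [T s' - T s = t (T u - T v)] almost surely. *)
exists (s + inK t *: (u - v)).
  have -> : x - (s + inK t *: (u - v)) =
      inK t *: ((c + inK t^-1 *: (x - s) - u) - (c - v)).
    rewrite -(addrA c) (addrC c) addrKA opprK -addrA (addrC (- u)).
    rewrite [RHS]scalerDr scalerA -scalar_of_realM divff ?gt_eqF//.
    by rewrite scalar_of_real1 scale1r opprD addrA -scalerN opprB.
  rewrite rnormZ gtr0_norm// -ltr_pdivlMl//.
  apply: le_lt_trans (rdist_triangle 0 _ _) _.
  by rewrite subr0 (rnormB 0) subr0; lra.
have -> : eta%:E = ((eta / 2)%:E + (eta / 2)%:E)%E.
  by rewrite -EFinD; congr _%:E; lra.
apply: le_trans (leeD Au Av).
apply: ae_measure_leU; try exact: (measurable_dist_gt RY).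
apply: filterS (ae_linear_shift s (inK t) u v) => w /= ->.
rewrite rnormZ gtr0_norm// => tuv.
apply: contrapT => /not_orP[/negP + /negP]; rewrite -!leNgt => uw vw.
have := rdist_triangle (Tv 0 w) (Tv u w) (Tv v w).
rewrite (rnormB (Tv 0 w)).
have : 2 * n.+1%:R < rnorm (Tv u w - Tv v w).
  by move: tuv; rewrite /t mulrAC ltr_pdivlMr// ltr_pM2l.
by rewrite -natr1; lra.
Qed.

(** The point [s n] is kept within [r n] of [x], where [r n] is the radius of near continuity for
    the n-th errors. These radii are fixed before [x], so [r 0] serves for all [x]. *)
Lemma approximating_sequence x0 tau eta : 0 < tau -> 0 < eta ->
  exists2 r, 0 < r & forall x, rnorm (x - x0) < r ->
    exists s : nat -> X, [/\ s 0%N = x0, s n @[n --> \oo] --> x &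
      forall n,
        (P [set w | (tau * 2^-1 ^+ n < rnorm (Tv (s n.+1) w - Tv (s n) w))%R]
         <= (eta * 2^-1 ^+ n)%:E)%E].
Proof.
move=> tau0 eta0.
have e0 n : 0 < 2^-1 ^+ n :> R by rewrite exprn_gt0.
have near_cont n :=
  cid2 (nearly_continuous (mulr_gt0 tau0 (e0 n)) (mulr_gt0 eta0 (e0 n))).
pose r n := s2val (near_cont n).
have r0 n : 0 < r n := s2valP (near_cont n).
have rP n : _ := s2valP' (near_cont n).
exists (r 0%N) => // x x_x0.
have step (ns : nat * X) : exists s', rnorm (x - ns.2) < r ns.1 ->
    [/\ rnorm (x - s') < r ns.1.+1, rnorm (x - s') < 2^-1 ^+ ns.1 &
     (P [set w | (tau * 2^-1 ^+ ns.1 < rnorm (Tv s' w - Tv ns.2 w))%R]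
      <= (eta * 2^-1 ^+ ns.1)%:E)%E].
  have [xs|nxs] := pselect (rnorm (x - ns.2) < r ns.1); last by exists 0.
  (* The first entry lets the next step start; the second gives convergence to [x]. *)
  have rho0 : 0 < Num.min (r ns.1.+1) (2^-1 ^+ ns.1) by rewrite lt_min r0 e0.
  have [s' + Ps'] := rP _ _ _ xs _ rho0.
  by rewrite lt_min => /andP[xs1 xs2]; exists s'.
have [f fP] := choice step.
pose fix s n := if n is m.+1 then f (m, s m) else x0.
have sr n : rnorm (x - s n) < r n.
  by elim: n => [|n IH] /=; [rewrite /= |have [] := fP (n, s n) IH].
exists s; split=> [//||n]; last by have [] := fP (n, s n) (sr n).
apply/cvg_rnormP => e e1; have [N Ne] := half_exp_small 1 e1.
exists N.+1 => // -[//|n] /= Nn; have [_ /= xn _] := fP (n, s n) (sr n).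
by apply: lt_trans xn _; have := Ne n Nn; rewrite mul1r.
Qed.

(** * From the closed graph to continuity *)

Lemma random_closed_graph alpha :
  probably_closed_graph_ge T alpha -> probably_continuous_ge T alpha.
Proof.
move=> closedT x0 tau0 eps tau0_gt0 /andP[eps0 eps_alpha].
(* Thus [2 * tau < tau0], and the exceptional event costs at most [2 * eta], half of [alpha - eps],
   which leaves more than [eps]. *)
pose tau := tau0 / 3; pose eta := (alpha - eps) / 4.
have tau_gt0 : 0 < tau by rewrite divr_gt0.
have eta_gt0 : 0 < eta by rewrite divr_gt0// subr_gt0.
have [delta delta0 approx] := approximating_sequence x0 tau_gt0 eta_gt0.
exists delta => // x /approx[s [s0 sx sP]].
have [f mf fP] := fast_cauchy_in_probability RY (ltW tau_gt0) (ltW eta_gt0)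
  (fun n => mT (s n)) sP.
have [z zE] := random_var_of P (borel_mapB RY (mT x) mf).
have mz := borel_map_rv z.
have mD m r : measurable [set w | r < rnorm (f w - Tv (s m) w)].
  exact: (measurable_dist_gt RY).
(* Almost surely [z = T x - f], the limit in probability of [T (x - s n)], while [x - s n] tends to
   0. *)
have ST_z : separating_subspace T z.
  exists (fun n => x - s n).
    move/cvg_rnormP : sx => sx; apply/cvg_rnormP => e /sx.
    by apply: filterS => n; rewrite sub0r opprB rnormB.
  move=> r r_gt0; apply/measure_cvg0P => e e0.
  have [N Ntau] := half_exp_small (2 * tau) r_gt0.
  have [M Meta] := half_exp_small (2 * eta) e0.
  exists (maxn N M) => // n /=; rewrite geq_max => /andP[/Ntau ntau /Meta neta].
  apply: le_trans (le_trans (fP n) _); last by rewrite lee_fin ltW.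
  (* The empty event fills the second slot of the union bound. *)
  rewrite -[leRHS]adde0 -(measure0 P); apply: ae_measure_leU => //.
    exact: (measurable_dist_ge RY).
  apply: filterS2 zE (ae_linearB x (s n)) => w /= zw Tw.
  rewrite zw Tw opprB addrC addrA subrK => rn; left.
  exact: lt_le_trans ntau rn.
have mA : measurable [set w | rnorm (Tv x w - Tv x0 w) < tau0].
  exact: (measurable_dist_lt RY).
have mz0 : measurable [set w | rv_val z w = 0].
  exact: borel_map_closed mz (@closed_rnorm0 _ _ Y).
(* Where [z] vanishes, [T x = f], and off the exceptional event [f] is within [2 * tau] of
   [T (s 0) = T x0]. *)
have : (P [set w | rv_val z w = 0%R]
    <= P [set w | (rnorm (Tv x w - Tv x0 w) < tau0)%R]
     + P [set w | (2 * tau * 2^-1 ^+ 0 < rnorm (f w - Tv (s 0%N) w))%R])%E.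
  apply: ae_measure_leU => //; apply: filterS zE => w /= zw.
  rewrite zw => /subr0_eq ->; rewrite s0 expr0 mulr1.
  have [?|le_tau] := ltP (2 * tau) (rnorm (f w - Tv x0 w)); first by right.
  by left; apply: le_lt_trans le_tau _; rewrite /tau; lra.
have := fP 0%N; have := closedT z ST_z.
have PE A : measurable A -> P A = (fine (P A))%:E.
  by move=> mA'; rewrite fineK// fin_num_measure.
rewrite (PE _ mA) (PE _ mz0) (PE _ (mD 0%N _)) -EFinD !lee_fin lte_fin expr0.
by rewrite /eta; lra.
Qed.

(** * From continuity to the closed graph *)

Lemma probably_closed_graph_of_continuous alpha : 0 <= alpha ->
  probably_continuous_ge T alpha -> probably_closed_graph_ge T alpha.
Proof.
move=> alpha0 contT y [x_ /cvg_rnormP x_0 Tx_y].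
have my := borel_map_rv y.
have m0 : borel_map (fun=> 0 : Y) := @measurable_cst _ _ _ _ _ _.
have my0 : measurable [set w | rv_val y w = 0].
  exact: borel_map_closed my (@closed_rnorm0 _ _ Y).
(* Where [T x_n] has norm below [tau] and is within [tau] of [y], the norm of [y] is below
   [2 * tau]. *)
have y_small eps tau : 0 < eps < alpha -> 0 < tau ->
    (eps%:E <= P [set w | (rnorm (rv_val y w - 0) <= 2 * tau)%R])%E.
  move=> eps_alpha tau0.
  have [delta delta0 Tdelta] := contT 0 tau eps tau0 eps_alpha.
  have my2 : measurable [set w | rnorm (rv_val y w - 0) <= 2 * tau].
    exact: (measurable_dist_le RY).
  apply/lee_addgt0Pr => e e0.
  have [N _ N0] := x_0 _ delta0.
  have /measure_cvg0P/(_ _ e0)[M _ Me] := Tx_y tau tau0.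
  pose n := maxn N M.
  have ltP : (eps%:E < P [set w | (rnorm (Tv (x_ n) w - Tv 0 w) < tau)%R])%E.
    by apply: Tdelta; rewrite rnormB; apply: N0; exact: leq_maxl.
  apply: le_trans (ltW ltP) _.
  apply: le_trans (leeD (lexx _) (Me n (leq_maxr _ _))).
  apply: ae_measure_leU => //; first exact: (measurable_dist_lt RY).
    exact: (measurable_dist_ge RY).
  apply: filterS ae_linear0 => w /= T0; rewrite T0 => Tx_small.
  have [|near_y] := leP tau (rnorm (Tv (x_ n) w - rv_val y w)); [by right|left].
  have := rdist_triangle (Tv (x_ n) w) (rv_val y w) 0.
  by rewrite (rnormB _ (Tv (x_ n) w)); lra.
rewrite leNgt; apply/negP => lt_alpha.
have Pfin := fineK (fin_num_measure P _ my0).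
set p := fine _ in Pfin.
have p0 : 0 <= p by rewrite -lee_fin Pfin measure_ge0.
have p_alpha : p < alpha by rewrite -lte_fin Pfin.
(* The excess over the event [y = 0] decreases to the empty set, so its probability drops below a
   quarter of the gap [alpha - p]. *)
pose B m := [set w | rnorm (rv_val y w - 0) <= 2 * 2^-1 ^+ m]
            `\` [set w | rv_val y w = 0].
have mB m : measurable (B m).
  by apply: measurableD => //; exact: (measurable_dist_le RY).
have [| | |m Bm] := @measure_small _ _ _ P B ((alpha - p) / 4) mB.
- move=> m n mn w [/= yn y0]; split => //=; apply: le_trans yn _.
  by rewrite ler_wpM2l// ler_wiXn2l// invf_le1// ler1n.
- apply/seteqP; split=> // w By; have [_] := By 0%N I; apply.
  apply: rnorm0_eq0; rewrite -[rv_val y w]subr0.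
  apply/eqP; rewrite eq_le rnorm_ge0 andbT; apply/ler_addgt0Pr => e e0.
  have [N /(_ N (leqnn N)) Ne] := half_exp_small 2 e0.
  by have [/= yN _] := By N I; lra.
- by rewrite divr_gt0// subr_gt0.
(* The midpoint exceeds [p + (alpha - p) / 4], which contradicts [y_small]; it is positive since
   [0 <= p < alpha]. *)
have eps_alpha : 0 < (p + alpha) / 2 < alpha by apply/andP; split; lra.
have := y_small _ _ eps_alpha (exprn_gt0 m (_ : 0 < 2^-1 :> R)).
rewrite invr_gt0 ltr0n => /(_ isT); apply/negP; rewrite -ltNge.
apply: (@le_lt_trans _ _ (p%:E + ((alpha - p) / 4)%:E)%E); last first.
  by rewrite -EFinD lte_fin; lra.
rewrite Pfin; apply: le_trans (leeD (lexx _) Bm).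
apply: ae_measure_leU => //; first exact: (measurable_dist_le RY).
apply: aeW => w /= yw; have [|] := pselect (rv_val y w = 0); first by left.
by right.
Qed.

End ClosedGraph.

Theorem corollary4p11 (d : measure_display) (Omega : measurableType d)
  (R : realType) (P : probability Omega R) (k : scalar_kind)
  (X Y : completeNormedModType (scalars R k))
  (RY_linear : random_vars_linear_space P Y)
  (T : X -> random_var P Y) (T_linear : linear_random_operator T) :
  probably_continuous_eq T (probability_of_continuity T) <->
  probably_closed_graph_eq T (probability_of_continuity T).
Proof.
have PQ beta : 0 <= beta <= 1 ->
    probably_continuous_ge T beta <-> probably_closed_graph_ge T beta.
  move=> /andP[beta0 _]; split.
    exact: probably_closed_graph_of_continuous.
  exact: random_closed_graph.
split=> -[a01 Qa largest]; split=> //.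
- exact/PQ.
- by move=> beta b01 /(PQ _ b01); exact: largest.
- exact/PQ.
- by move=> beta b01 /(PQ _ b01); exact: largest.
Qed.
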